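(* For every integer $n\ge 2$, $R(c(nK_3),c(nK_3))=7n-2$.
   Context: $nK_3$ denotes $n$ pairwise vertex-disjoint triangles. $c(nK_3)$ (a connected triangle matching) denotes any connected graph containing $n$ pairwise vertex-disjoint triangles. $R(c(nK_3),c(nK_3))$ denotes the smallest positive integer $N$ such that in every coloring of the edges of the complete graph $K_N$ with two colors (red and blue), there is a color for which the graph formed by the edges of that color contains, as a subgraph, some connected graph containing $n$ pairwise vertex-disjoint triangles (equivalently, some connected component of one of the two color classes contains $n$ pairwise vertex-disjoint triangles). *)

(* Defs.v *)
From mathcomp Require Import all_boot.

Set Implicit Arguments.
Unset Strict Implicit.
Unset Printing Implicit Defensive.

Record sgraph := SGraph {
  vertex :> finType;
  edge : rel vertex;
  edge_sym : symmetric edge;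
  edge_irr : irreflexive edge }.

(* G is, up to isomorphism, a (not necessarily induced) subgraph of H. *)
Definition subgraph (G H : sgraph) : Prop :=
  exists2 f : G -> H,
    injective f & forall x y : G, edge x y -> edge (f x) (f y).

(* The graph without vertices counts as connected; it never belongs to the
   family [cnK3 n] when n > 0. *)
Definition connected (G : sgraph) : Prop :=
  forall x y : G, connect (@edge G) x y.

(* n K_3: the vertex (i, a) is corner a of the i-th triangle. *)
Definition nK3_edge (n : nat) : rel ('I_n * 'I_3) :=
  fun u v => (u.1 == v.1) && (u.2 != v.2).

Lemma nK3_edge_sym n : symmetric (@nK3_edge n).
Proof. by move=> u v; rewrite /nK3_edge (eq_sym u.1) (eq_sym u.2). Qed.

Lemma nK3_edge_irr n : irreflexive (@nK3_edge n).
Proof. by move=> u; rewrite /nK3_edge !eqxx. Qed.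

Definition nK3 (n : nat) : sgraph := SGraph (@nK3_edge_sym n) (@nK3_edge_irr n).

(* c(n K_3), as the family of all connected graphs containing n K_3. *)
Definition cnK3 (n : nat) (G : sgraph) : Prop :=
  connected G /\ subgraph (nK3 n) G.

(* A 2-colouring of the edges of K_N is a map c : {set 'I_N} -> bool, of which
   only the values on 2-element sets matter: c [set x; y] is the colour of the
   edge xy. *)
Definition color_edge (N : nat) (c : {set 'I_N} -> bool) (b : bool) : rel 'I_N :=
  fun x y => (x != y) && (c [set x; y] == b).

Lemma color_edge_sym N c b : symmetric (@color_edge N c b).
Proof. by move=> x y; rewrite /color_edge eq_sym setUC. Qed.

Lemma color_edge_irr N c b : irreflexive (@color_edge N c b).
Proof. by move=> x; rewrite /color_edge eqxx. Qed.

Definition color_graph (N : nat) (c : {set 'I_N} -> bool) (b : bool) : sgraph :=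
  SGraph (@color_edge_sym N c b) (@color_edge_irr N c b).

Definition contains_member (F : sgraph -> Prop) (G : sgraph) : Prop :=
  exists2 H : sgraph, F H & subgraph H G.

(* Red is [true], blue is [false]. *)
Definition ramsey_arrow (F1 F2 : sgraph -> Prop) (N : nat) : Prop :=
  forall c : {set 'I_N} -> bool,
    contains_member F1 (color_graph c true) \/
    contains_member F2 (color_graph c false).

(* R(F1, F2) exists and equals N. *)
Definition is_ramsey_number (F1 F2 : sgraph -> Prop) (N : nat) : Prop :=
  [/\ 0 < N, ramsey_arrow F1 F2 N &
      forall M : nat, 0 < M -> ramsey_arrow F1 F2 M -> N <= M].

(* Main.v *)
Require Import Defs.
From mathcomp Require Import all_boot zify.

(** Lower bound: split 7n-3 vertices into parts of sizes 3n-1, 3n-1, n-1, and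
    colour an edge red iff it lies inside a part.  A red component is too small
    for n triangles, and every blue triangle meets the part of size n-1.

    Upper bound: on 6n vertices one extracts disjoint monochromatic triangles
    greedily until n have the same colour, which suffices if both colours are
    connected.  Otherwise say that red is disconnected, so that blue contains
    all edges between X and its complement Y for a union X of red components,
    and any n disjoint blue triangles are linked in blue.  Blue edges inside X,
    respectively Y, are completed to blue triangles by vertices of the other
    side; they are provided by the following lemma.  If t <= n, then 3n-1+t
    vertices carry t disjoint blue edges or a red connected triangle matching
    of size n.  Indeed, let a blue matching of size m < t be non-extendable.
    The uncovered vertices form a red clique, and from each matching edge some
    endpoint has at most one blue neighbour in that clique, so that it lies in
    a red triangle with two clique vertices.  These m triangles and n-m
    triangles inside the clique are disjoint.
    If |X|, |Y| >= n, the lemma gives s blue edges in X and n-s in Y.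
    If no such X exists, one red component has a complement of size y < n;
    there one takes n-y disjoint blue triangles greedily, and then y blue edges
    to be joined to the complement. *)

Set Implicit Arguments.
Unset Strict Implicit.
Unset Printing Implicit Defensive.

(** * Packings of triangles and matchings *)

Section Packings.
Variable T : finType.
Implicit Types (e r b : rel T) (S X Y U C R : {set T}) (s : seq (T * T)).

Definition triangle e x y z := [&& e x y, e y z & e x z].

(** Disjointness is encoded by deletion: each triangle is chosen among the vertices left by the
    previous ones. For irreflexive [e] its corners are automatically distinct. *)
Fixpoint tripack e k S : Prop :=
  if k is k'.+1 then
    exists x y z, [/\ [/\ x \in S, y \in S & z \in S], triangle e x y z
                    & tripack e k' (S :\: [set x; y; z])]
  else True.

Lemma tripackS e k S S' : S \subset S' -> tripack e k S -> tripack e k S'.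
Proof.
elim: k S S' => [|k IH] S S' //= sS [x [y [z [[xS yS zS] t P]]]].
exists x, y, z; split=> //; first by rewrite !(subsetP sS).
by apply: IH P; apply: setSD.
Qed.

Lemma tripackU e k l S S' : [disjoint S & S'] ->
  tripack e k S -> tripack e l S' -> tripack e (k + l) (S :|: S').
Proof.
move=> dS + P'; elim: k S dS => [|k IH] S dS /=.
  by move=> _; apply: tripackS P'; apply: subsetUr.
move=> [x [y [z [[xS yS zS] t P]]]]; exists x, y, z.
split=> //; first by rewrite !inE xS yS zS.
have dS' : [disjoint S :\: [set x; y; z] & S'].
  by apply: disjointWl dS; apply: subsetDl.
apply: tripackS (IH _ dS' P); apply/subsetP => v; rewrite !inE.
case/orP => [/andP[-> ->] //|vS']; rewrite vS' orbT andbT.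
have vS : v \notin S by rewrite (disjointFl dS).
by apply: contra vS => /orP[/orP[]|] /eqP->.
Qed.

Lemma card_set3 (x y z : T) : #|[set x; y; z]| <= 3.
Proof.
by apply: leq_trans (leq_card_setU _ _) _; rewrite cards2 cards1; case: eqP.
Qed.

Lemma card_setD3 S (x y z : T) : #|S| <= #|S :\: [set x; y; z]| + 3.
Proof.
have := card_set3 x y z; have := cardsID [set x; y; z] S.
have := subset_leq_card (subsetIr S [set x; y; z]); lia.
Qed.

Lemma tripack_clique e k S : (forall x y, x \in S -> y \in S -> x != y -> e x y) ->
  3 * k <= #|S| -> tripack e k S.
Proof.
elim: k S => [|k IH] S //= cl hS.
have /card_gt2P[x [y [z [[xS yS zS] [xy yz zx]]]]] : 2 < #|S| by lia.
exists x, y, z; split=> //.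
  by rewrite /triangle !cl // eq_sym.
apply: IH; last by have := card_setD3 S x y z; lia.
by move=> u v; rewrite !inE => /andP[_ uS] /andP[_ vS]; apply: cl.
Qed.

Definition verts s := flatten [seq [:: p.1; p.2] | p <- s].

Definition matching e s R :=
  [&& uniq (verts s), all (fun p => e p.1 p.2) s & all (mem R) (verts s)].

Lemma size_verts s : size (verts s) = 2 * size s.
Proof. by elim: s => //= p s; rewrite -/(verts s) => ->; lia. Qed.

Lemma card_verts s : uniq (verts s) -> #|[set x in verts s]| = 2 * size s.
Proof. by rewrite cardsE -size_verts => /card_uniqP. Qed.

Lemma matching_card_setD {e s R} : matching e s R ->
  #|R :\: [set x in verts s]| = #|R| - 2 * size s.
Proof.
case/and3P => us _ /allP sR; rewrite cardsD (setIidPr _) ?card_verts //.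
by apply/subsetP => x; rewrite inE => /sR.
Qed.

Lemma perm_verts s p : p \in s ->
  perm_eq (verts s) (p.1 :: p.2 :: verts (rem p s)).
Proof.
move=> ps; rewrite -[p.1 :: _]/(verts (p :: rem p s)).
exact/perm_flatten/perm_map/perm_to_rem.
Qed.

(** The root [u] selects one component; this form of the family [cnK3] serves until the translation
    back to graphs. *)
Definition linked_pack e k := exists u, tripack e k [set x | connect e u x].

Lemma closed_component e u : symmetric e -> closed e [set x | connect e u x].
Proof.
move=> e_sym x y xy; rewrite !inE; apply: same_connect_r.
  exact: sym_connect_sym.
exact: connect1.
Qed.

Lemma mono_triangle_nbrs r b S x :
  symmetric b -> (forall y z, y != z -> r y z || b y z) ->
  2 < #|[set y in S | r x y]| ->
  x \in S ->
  exists x y z, [/\ x \in S, y \in S & z \in S] /\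
    (triangle r x y z \/ triangle b x y z).
Proof.
move=> b_sym rb; case/card_gt2P => [u [v [w [[]]]]]; rewrite !inE.
move=> /andP[uS xu] /andP[vS xv] /andP[wS xw] [uv vw wu] xS.
case uvr : (r u v); first by exists x, u, v; split; [|left; apply/and3P].
case vwr : (r v w); first by exists x, v, w; split; [|left; apply/and3P].
case wur : (r w u); first by exists x, w, u; split; [|left; apply/and3P].
exists u, v, w; split=> //; right; apply/and3P; split.
- by have := rb _ _ uv; rewrite uvr.
- by have := rb _ _ vw; rewrite vwr.
- by rewrite b_sym; have := rb _ _ wu; rewrite wur.
Qed.

(** * Two-coloured complete graphs *)

Section TwoColours.
Variables r b : rel T.
Hypotheses (r_sym : symmetric r) (b_sym : symmetric b).
Hypothesis b_irr : irreflexive b.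
Hypothesis rb : forall x y, x != y -> r x y || b x y.

(** Induction on [s]: each pair yields a triangle with two vertices of [U], which lowers [k] by one
    and [#|U| + size s] by three; the clique supplies the rest. The condition on [p.1] and [p.2]
    excludes augmenting paths of length three. *)
Lemma matched_clique_pack C U s k :
  closed r C -> U \subset C -> {in U &, forall x y, x != y -> r x y} ->
  uniq (verts s) -> {in verts s, forall v, v \notin U} ->
  {in s, forall p, {in U &, forall w w', b p.1 w -> b p.2 w' -> w = w'}} ->
  size s < k -> 3 * k <= #|U| + size s ->
  tripack r k (C :&: (U :|: [set x in verts s])).
Proof.
move=> clC; elim: s U k => [|p s IH] U k UC Ucl us sU aug sk hU.
  apply: (@tripackS _ _ U); last by rewrite addn0 in hU; apply: tripack_clique.
  by rewrite subsetI UC subsetUl.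
case: k sk hU => // k /= sk hU.
move: us sU; rewrite /verts /= -/(verts s) !inE negb_or -andbA.
case/and4P => p12 p1s p2s us sU.
(* If [p.1] has two [b]-neighbours in [U], a [b]-neighbour of [p.2] in [U] would have to equal
   both. *)
have [v [vp vn]] : exists v, v \in [:: p.1; p.2] /\ #|U :&: [set w | b v w]| <= 1.
  case: (leqP #|U :&: [set w | b p.1 w]| 1) => [h|].
    by exists p.1; rewrite !inE eqxx.
  case/card_gt1P => [w1 [w2 []]]; rewrite !inE => /andP[w1U w1b] /andP[w2U w2b] w12.
  exists p.2; rewrite !inE eqxx orbT; split=> //.
  rewrite (_ : _ :&: _ = set0) ?cards0 //; apply/setP => w; rewrite !inE.
  apply/negP => /andP[wU wb]; case/eqP: w12.
  have ps : p \in p :: s by rewrite inE eqxx.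
  by rewrite (aug p ps w1 w) // (aug p ps w2 w).
have vs : v \notin verts s.
  by move: vp; rewrite !inE => /orP[] /eqP->.
have vU : v \notin U by apply: sU; move: vp; rewrite !inE => /orP[]->; rewrite ?orbT.
have /card_gt1P[a [a' []]] : 1 < #|U :\: [set w | b v w]|.
  have := cardsID [set w | b v w] U; lia.
rewrite !inE => /andP[nva aU] /andP[nva' a'U] aa'.
have va : r v a.
  have /rb : v != a by apply: contraNneq vU => ->.
  by rewrite (negbTE nva) orbF.
have va' : r v a'.
  have /rb : v != a' by apply: contraNneq vU => ->.
  by rewrite (negbTE nva') orbF.
have vC : v \in C by rewrite (clC _ _ va) (subsetP UC).
have vps : v \in verts (p :: s).
  by rewrite /verts /= -/(verts s) !inE; move: vp; rewrite !inE => /orP[]->; rewrite ?orbT.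
exists v, a, a'; split.
- by rewrite !in_setI !in_setU !in_set vC vps !(subsetP UC) // aU a'U orbT.
- by rewrite /triangle va va' Ucl.
have sub : U :\: [set a; a'] \subset U by apply: subsetDl.
apply: (tripackS _ (IH (U :\: [set a; a']) k _ _ us _ _ _ _)).
- apply/subsetP => x; rewrite !inE => /andP[-> /orP[]].
    case/andP => xa xU; rewrite xU andbT -orbA negb_or xa andbT.
    by apply: contraNneq vU => <-.
  move=> xs; rewrite xs !orbT !andbT.
  have xU : x \notin U by apply: sU; rewrite !inE xs !orbT.
  apply/negP => /orP[/orP[]|] /eqP xx; move: xU xs; rewrite xx ?aU ?a'U //.
  by rewrite (negbTE vs).
- exact: subset_trans sub UC.
- by move=> x y /(subsetP sub) xU /(subsetP sub) yU; apply: Ucl.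
- move=> x xs; apply/negP => /(subsetP sub); apply/negP; apply: sU.
  by rewrite !inE xs !orbT.
- move=> q qs w w' /(subsetP sub) wU /(subsetP sub) w'U; apply: aug => //.
  by rewrite inE qs orbT.
- exact: sk.
- have := cardsID [set a; a'] U; have := subset_leq_card (subsetIr U [set a; a']).
  by rewrite cards2 aa'; move: hU; clear; lia.
Qed.

Lemma matching_or_linked_pack n t R : t <= n -> 3 * n + t <= #|R|.+1 ->
  (exists2 s, size s = t & matching b s R) \/ linked_pack r n.
Proof.
elim: t => [|t IH] tn hR; first by left; exists [::].
have [[s st sm]|] := IH (ltnW tn) ltac:(lia); last by right.
have hU := matching_card_setD sm.
set U := R :\: _ in hU.
have [us sb sR] := and3P sm.
case: (boolP [exists x in U, exists y in U, b x y]) => [|nb].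
  case/exists_inP => x xU /exists_inP[y yU bxy]; left; exists ((x, y) :: s).
    by rewrite /= st.
  move: xU yU; rewrite !inE => /andP[xs xR] /andP[ys yR].
  rewrite /matching /verts /= -/(verts s) us sb sR bxy xR yR !inE negb_or xs ys.
  by rewrite !andbT; apply: contraTneq bxy => ->; rewrite b_irr.
have Ucl : {in U &, forall x y, x != y -> r x y}.
  move=> x y xU yU /rb; case: (r x y) => //= bxy; case/negP: nb.
  by apply/exists_inP; exists x => //; apply/exists_inP; exists y.
(* The other way to extend: on an augmenting path [w], [p.1], [p.2], [w'], the two outer edges
   replace the middle one. *)
case: (boolP [exists w in U, exists w' in U,
    (w != w') && has (fun p => b p.1 w && b p.2 w') s]) => [|na].
  case/exists_inP => w wU /exists_inP[w' w'U /andP[ww' /hasP[p ps /andP[pw pw']]]].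
  left; exists [:: (p.1, w), (p.2, w') & rem p s].
    by rewrite /= size_rem // -st prednK //; case: (s) ps.
  move: wU w'U; rewrite !inE => /andP[ws wR] /andP[w's w'R].
  have pm := perm_verts ps.
  move: us sR ws w's; rewrite (perm_uniq pm) (perm_all _ pm) !(perm_mem pm) /=.
  rewrite !inE !negb_or => /and3P[/andP[p12 p1s] p2s us'] /and3P[p1R p2R sR'].
  move=> /and3P[wp1 wp2 ws] /and3P[w'p1 w'p2 w's].
  rewrite /matching /verts /= -/(verts _) !inE !negb_or pw pw' us' sR' p1R p2R wR w'R.
  rewrite p12 p1s p2s ws w's ww' (eq_sym p.1 w) (eq_sym p.1 w') (eq_sym p.2 w').
  rewrite wp1 wp2 w'p1 w'p2 /= !andbT.
  by apply/allP => q /mem_rem qs; apply: (allP sb).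
right.
have /card_gt0P [u uU] : 0 < #|U| by lia.
exists u; set C := [set x | _].
have := @matched_clique_pack C U s n (closed_component _ r_sym) _ Ucl us _ _ _ _.
move=> P; apply: tripackS (P _ _ _ _ _); first by apply: subsetIl.
- apply/subsetP => x xU; rewrite inE; case: (eqVneq u x) => [->//|ux].
  exact/connect1/Ucl.
- by move=> v vs; rewrite !inE vs.
- move=> p ps w w' wU w'U pw pw'; apply/eqP; apply/negPn/negP => ww'; case/negP: na.
  apply/exists_inP; exists w => //; apply/exists_inP; exists w' => //.
  by rewrite ww'; apply/hasP; exists p => //; rewrite pw.
- lia.
- lia.
Qed.

(** This is R(3,3) <= 6: among five other vertices, three are joined to [x] in the same colour. *)
Lemma mono_triangle S : 5 < #|S| ->
  exists x y z, [/\ x \in S, y \in S & z \in S] /\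
    (triangle r x y z \/ triangle b x y z).
Proof.
move=> hS; have /card_gt0P[x xS] : 0 < #|S| by lia.
case: (ltnP 2 #|[set y in S | r x y]|) => [h|hr].
  exact: mono_triangle_nbrs b_sym rb h xS.
case: (ltnP 2 #|[set y in S | b x y]|) => [h|hb].
  have br y z : y != z -> b y z || r y z by rewrite orbC; apply: rb.
  have [u [v [w [h1 h2]]]] := mono_triangle_nbrs r_sym br h xS.
  by exists u, v, w; split=> //; case: h2; [right|left].
have sub : S \subset x |: ([set y in S | r x y] :|: [set y in S | b x y]).
  apply/subsetP => y yS; rewrite !inE yS /=.
  by case: (eqVneq y x) => //= yx; apply: rb; rewrite eq_sym.
have := subset_leq_card sub; rewrite cardsU1.
have := leq_of_leqif (leq_card_setU [set y in S | r x y] [set y in S | b x y]).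
have := leq_b1 (x \notin [set y in S | r x y] :|: [set y in S | b x y]).
lia.
Qed.

(** Each extracted triangle lowers [k + l] by one and costs three vertices. While [k] and [l] are
    both positive, at least six vertices remain. *)
Lemma greedy_packs k l S : 3 * (k + l) <= #|S| -> tripack r k S \/ tripack b l S.
Proof.
elim: {k l}(k + l) {-2}k {-2}l (erefl (k + l)) S => [|m IH] [|k] [|l] kl S hS;
  try by [left | right | rewrite addSn in kl].
have /mono_triangle[x [y [z [xyzS h]]]] : 5 < #|S| by lia.
have hS' := card_setD3 S x y z.
case: h => t.
  case: (IH k l.+1 _ (S :\: [set x; y; z])) => [||P|P]; [lia|lia| |].
    by left; exists x, y, z.
  by right; apply: tripackS P; apply: subsetDl.
case: (IH k.+1 l _ (S :\: [set x; y; z])) => [||P|P]; [lia|lia| |].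
  by left; apply: tripackS P; apply: subsetDl.
by right; exists x, y, z.
Qed.

Lemma tripack_join s Y : uniq (verts s) -> all (fun p => b p.1 p.2) s ->
  {in verts s & Y, forall x y, b x y} -> size s <= #|Y| ->
  tripack b (size s) ([set x in verts s] :|: Y).
Proof.
elim: s Y => //= p s IH Y; rewrite {1 2 3}/verts /= -/(verts s) !inE negb_or -andbA.
case/and4P => p12 p1s p2s us /andP[pb sb] sY szY.
have [y yY] : exists y, y \in Y by apply/card_gt0P; lia.
have p1y : b p.1 y by apply: sY; rewrite ?inE ?eqxx.
have p2y : b p.2 y by apply: sY; rewrite ?inE ?eqxx ?orbT.
(* A common vertex of [verts s] and [Y] would be [b]-adjacent to itself. *)
have ys : y \notin verts s.
  by apply/negP => ys; have := sY y y; rewrite !inE ys !orbT b_irr => /(_ isT yY).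
exists p.1, p.2, y; split; first by split; rewrite !inE ?eqxx ?orbT ?yY ?orbT.
  by rewrite /triangle pb p1y p2y.
apply: tripackS (IH (Y :\ y) us sb _ _).
- apply/subsetP => x; rewrite !inE => /orP[xs|/andP[xy xY]].
    rewrite xs !orbT andbT; apply/negP => /orP[/orP[]|] /eqP xx; move: xs; rewrite xx;
    exact/negP.
  rewrite xY !orbT andbT (negbTE xy) orbF.
  apply/negP => /orP[] /eqP xx; have := sY x x; rewrite !inE xx eqxx ?orbT b_irr -xx => /(_ isT xY) //.
- by move=> u v us' /setD1P[_ vY]; apply: sY => //; rewrite !inE us' !orbT.
- by have := cardsD1 y Y; rewrite yY; lia.
Qed.

(** * One colour absent between [X] and its complement *)

Section Split.
Variable X : {set T}.
Hypothesis clX : closed r X.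

Lemma closed_cross x y : x \in X -> y \notin X -> b x y.
Proof.
move=> xX yX; have /rb : x != y by apply: contraNneq yX => <-.
by case: (boolP (r x y)) => // /clX; rewrite xX (negbTE yX).
Qed.

(** Every vertex is within two [b]-steps of [x], through [y] if it lies in [X]. *)
Lemma linked_pack_cross x y k : x \in X -> y \notin X ->
  tripack b k setT -> linked_pack b k.
Proof.
move=> xX yX P; exists x; apply: tripackS P; apply/subsetP => z _; rewrite inE.
case: (boolP (z \in X)) => zX; last exact/connect1/closed_cross.
apply: (connect_trans (connect1 (closed_cross xX yX))).
by apply: connect1; rewrite b_sym; apply: closed_cross.
Qed.

(** Edges of [s] take their third vertices from the part of [~: X] missed by [t], those of [t] from
    the part of [X] missed by [s]; the size bounds count these free vertices. *)
Lemma join_matchings s t : matching b s X -> matching b t (~: X) ->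
  2 * size s + size t <= #|X| -> size s + 2 * size t <= #|~: X| ->
  tripack b (size s + size t) setT.
Proof.
move=> sm tm; have := matching_card_setD sm; have := matching_card_setD tm.
case/and3P: sm => us sb /allP sX; case/and3P: tm => ut tb /allP tX.
set Y0 := ~: X :\: _; set X0 := X :\: _ => hY hX h1 h2.
have P : tripack b (size s) ([set x in verts s] :|: Y0).
  apply: tripack_join => //; last by lia.
  by move=> u v /sX /= uX /setDP[]; rewrite in_setC => vX _; apply: closed_cross.
have Q : tripack b (size t) ([set x in verts t] :|: X0).
  apply: tripack_join => //; last by lia.
  move=> u v /tX /=; rewrite in_setC => uX /setDP[vX _].
  by rewrite b_sym; apply: closed_cross.
apply: tripackS (tripackU _ P Q) => //.
rewrite disjoint_subset; apply/subsetP => x; rewrite !inE.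
case/orP => [xs|/andP[/negbTE-> /negbTE->]]; last by rewrite andbF.
by rewrite xs /= orbF; apply/negP => /tX; rewrite /= in_setC => /negP[]; apply: sX.
Qed.

(* If X or Y has at least 4n-1 vertices, it contains all n blue edges; otherwise
   the sizes are 3n-1+s and at least 3n-1+(n-s) with 0 < s < n. *)
Lemma linked_pack_balanced n : 0 < n -> n <= #|X| -> n <= #|~: X| ->
  7 * n - 2 <= #|T| -> linked_pack r n \/ linked_pack b n.
Proof.
move=> n0 nX nY; rewrite -(cardsC X) => hT.
have /card_gt0P[x xX] : 0 < #|X| by lia.
have /card_gt0P[y] : 0 < #|~: X| by lia.
rewrite inE => yX.
have fin i j : i + j = n -> 2 * i + j <= #|X| -> i + 2 * j <= #|~: X| ->
  (exists2 s, size s = i & matching b s X) ->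
  (exists2 s, size s = j & matching b s (~: X)) -> linked_pack b n.
  move=> ij hi hj [s si sm] [t tj tm].
  apply: (linked_pack_cross xX yX); rewrite -ij -si -tj.
  by apply: join_matchings; rewrite ?si ?tj.
have nil R : exists2 s, size s = 0 & matching b s R by exists [::].
case: (leqP (4 * n) #|X|.+1) => hX.
  have [|M|] := @matching_or_linked_pack n n X (leqnn n); [lia| |by left].
  by right; apply: (fin n 0); rewrite ?addn0 ?muln0 //; lia.
case: (leqP (4 * n) #|~: X|.+1) => hY.
  have [|M|] := @matching_or_linked_pack n n (~: X) (leqnn n); [lia| |by left].
  by right; apply: (fin 0 n); rewrite ?muln0 //; lia.
set i := #|X|.+1 - 3 * n.
have [||M|] := @matching_or_linked_pack n i X; [lia|lia| |by left].
have [||N|] := @matching_or_linked_pack n (n - i) (~: X); [lia|lia| |by left].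
by right; apply: fin M N; lia.
Qed.

End Split.

Lemma tripack_support e k S : tripack e k S ->
  exists P : {set T}, [/\ P \subset S, #|P| <= 3 * k & tripack e k P].
Proof.
elim: k S => [|k IH] S /=; first by exists set0; rewrite sub0set cards0.
move=> [x [y [z [[xS yS zS] t /IH[P [PS hP PP]]]]]].
exists (P :|: [set x; y; z]); split.
- apply/subUsetP; split; first exact: subset_trans PS (subsetDl _ _).
  by apply/subsetP => v; rewrite !inE => /orP[/orP[]|] /eqP->.
- have := leq_of_leqif (leq_card_setU P [set x; y; z]); have := card_set3 x y z; lia.
- exists x, y, z; split=> //; first by rewrite !inE !eqxx !orbT.
  apply: tripackS PP; apply/subsetP => v vP; have := subsetP PS v vP.
  by rewrite !inE vP => /andP[->].
Qed.

Lemma linked_pack_component u n (X := [set x | connect r u x]) :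
  0 < #|~: X| < n -> 7 * n - 2 <= #|T| -> linked_pack r n \/ linked_pack b n.
Proof.
case/andP => Y0 Yn; rewrite -(cardsC X) => hT; set m := #|~: X| in Y0 Yn hT.
have clX : closed r X by apply: closed_component.
case: (@greedy_packs n (n - m) X) => [|P|]; [lia|by left; exists u|].
case/tripack_support => P [PX hP PP].
(* At least [4 * n - 2 + 2 * m] vertices of [X] lie outside [P], enough for the required
   [3 * n - 1 + m]. *)
case: (@matching_or_linked_pack n m (X :\: P)) => [|||]; [lia| | |by left].
  by have := cardsD X P; rewrite (setIidPr PX); lia.
case=> s sm /and3P[us sb /allP sX]; right.
have /card_gt0P[y] := Y0; rewrite inE => yX.
have uX : u \in X by rewrite inE.
apply: (linked_pack_cross clX uX yX).
have Q : tripack b m ([set x in verts s] :|: ~: X).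
  rewrite -sm; apply: tripack_join => //; last by rewrite sm.
  by move=> x z /sX /setDP[xX _]; rewrite inE => zX; apply: (closed_cross clX).
rewrite -(subnK (ltnW Yn)); apply: tripackS (tripackU _ PP Q) => //.
rewrite disjoint_subset; apply/subsetP => x xP; rewrite !inE negb_or.
have := subsetP PX _ xP; rewrite inE => ->; rewrite andbT.
by apply/negP => /sX /setDP[_]; rewrite xP.
Qed.

(* Descend to a smallest union of red components with at least n vertices. *)
Lemma linked_pack_disconnected n u v : 0 < n -> 7 * n - 2 <= #|T| ->
  ~~ connect r u v -> linked_pack r n \/ linked_pack b n.
Proof.
move=> n0 hT uv.
suff main m : forall X, #|X| < m -> closed r X -> n <= #|X| ->
    linked_pack r n \/ linked_pack b n.
  by apply: (main #|T|.+1 setT); rewrite ?cardsT //; [move=> ? ? _; rewrite !inE|lia].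
elim: m => // m IH X Xm clX nX.
case: (leqP n #|~: X|) => nY; first exact: (linked_pack_balanced clX n0 nX nY hT).
have /card_gt0P[w wX] : 0 < #|X| by lia.
set C := [set x | connect r w x].
have clC : closed r C by apply: closed_component.
have CX : C \subset X.
  by apply/subsetP => x; rewrite inE => /(closed_connect clX) <-.
case: (leqP n #|C|) => nC.
  case: (eqVneq C X) => [eCX|neCX]; last first.
    have /proper_card CX' : C \proper X by rewrite properEneq neCX.
    by apply: (IH C) => //; apply: leq_trans CX' Xm.
  apply: (@linked_pack_component w) => //; rewrite -/C eCX nY andbT.
  (* The component [X] cannot contain both [u] and [v]. *)
  apply/card_gt0P; case: (boolP (u \in X)) => uX; last by exists u; rewrite inE.
  exists v; rewrite inE -eCX inE; apply: contra uv => wv.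
  apply: connect_trans wv; rewrite (sym_connect_sym r_sym).
  by move: uX; rewrite -eCX inE.
have hXC : #|X :\: C| = #|X| - #|C| by rewrite cardsD (setIidPr CX).
have wC : w \in C by rewrite inE.
have C0 : 0 < #|C| by apply/card_gt0P; exists w.
(* A small component is discarded: [C] and [~: X] each have fewer than [n] vertices, so at least
   [5 * n] remain. *)
apply: (IH (X :\: C)); first lia.
  move=> x y xy; rewrite !inE; have := clC _ _ xy; rewrite !inE => ->.
  by rewrite (clX _ _ xy).
have := cardsC X; lia.
Qed.

End TwoColours.

Lemma connected_linked_pack e k u : (forall v, connect e u v) ->
  tripack e k setT -> linked_pack e k.
Proof.
by move=> con P; exists u; apply: tripackS P; apply/subsetP => v _; rewrite inE.
Qed.

Lemma linked_pack_two_colours r b n : symmetric r -> symmetric b ->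
  irreflexive r -> irreflexive b -> (forall x y, x != y -> r x y || b x y) ->
  1 < n -> 7 * n - 2 <= #|T| -> linked_pack r n \/ linked_pack b n.
Proof.
move=> r_sym b_sym r_irr b_irr rb n1 hT.
have br x y : x != y -> b x y || r x y by rewrite orbC; apply: rb.
case: (boolP [forall u, forall v, connect r u v]) => [/forallP rc|]; last first.
  rewrite negb_forall => /existsP[u]; rewrite negb_forall => /existsP[v].
  by apply: linked_pack_disconnected => //; apply: ltnW.
case: (boolP [forall u, forall v, connect b u v]) => [/forallP bc|]; last first.
  rewrite negb_forall => /existsP[u]; rewrite negb_forall => /existsP[v] uv.
  have n0 := ltnW n1.
  by case: (linked_pack_disconnected b_sym r_sym r_irr br n0 hT uv); [right|left].
have /card_gt0P[u _] : 0 < #|T| by lia.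
(* The greedy packing needs [6 * n <= 7 * n - 2], that is, [n >= 2]. *)
case: (greedy_packs r_sym b_sym rb (k := n) (l := n) (S := setT)) => [|P|P].
- by rewrite cardsT; lia.
- by left; apply: (connected_linked_pack (forallP (rc u))).
- by right; apply: (connected_linked_pack (forallP (bc u))).
Qed.

End Packings.

(** * Translation between packings and the family [cnK3] *)

Lemma tripack_embedding (T : finType) (e : rel T) k (S : {set T}) :
  symmetric e -> irreflexive e -> tripack e k S ->
  exists f : 'I_k * 'I_3 -> T,
    [/\ injective f, forall p q, nK3_edge p q -> e (f p) (f q)
      & forall p, f p \in S].
Proof.
move=> e_sym e_irr; elim: k S => [|k IH] S /=.
  by have f (p : 'I_0 * 'I_3) : T by [case: p => -[]]; exists f; split; case=> -[].
case=> x [y [z [[xS yS zS] /and3P[xy yz xz] /IH[f [f_inj f_hom fS]]]]].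
pose t (a : 'I_3) := nth x [:: x; y; z] a.
(* Index [ord0] is the triangle just found; the others are unlifted to [f], whose values avoid [x],
   [y] and [z]. *)
exists (fun p => if unlift ord0 p.1 is Some i then f (i, p.2) else t p.2).
have neq u v : e u v -> (u == v = false) * (v == u = false).
  by move=> uv; rewrite eq_sym; split; apply: contraTF uv => /eqP->; rewrite e_irr.
have t_in a : t a \in [set x; y; z].
  by rewrite /t !inE; case: a => -[|[|[|]]] //= _; rewrite eqxx ?orbT.
have tE a a' : a != a' -> e (t a) (t a').
  by rewrite /t; case: a a' => -[|[|[|]]] //= ? [[|[|[|]]]] //= ? _; rewrite // e_sym.
have ft i a a' : f (i, a) != t a'.
  apply: contraTneq (fS (i, a)) => ->; by rewrite inE t_in.
split.
- move=> [i a] [j a'] /=.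
  case: unliftP => [i'|] ->; case: unliftP => [j'|] -> /=.
  + by move/f_inj => -[-> ->].
  + by move/eqP; rewrite (negbTE (ft _ _ _)).
  + by move/eqP; rewrite eq_sym (negbTE (ft _ _ _)).
  + case: (eqVneq a a') => [-> //|/tE /neq[/eqP]]; by [].
- move=> [i a] [j a'] /=; rewrite /nK3_edge /= => /andP[/eqP-> aa'].
  by case: (unlift _ _) => [j'|]; [apply: f_hom; rewrite /nK3_edge /= eqxx|apply: tE].
- move=> [i a] /=; case: (unlift _ _) => [j|] /=.
    by have := fS (j, a) => /setDP[].
  by have := t_in a; rewrite !inE => /orP[/orP[]|] /eqP->.
Qed.

Section Component.
Variables (G : sgraph) (u : G).

Definition component_edge : rel {x : G | connect (@edge G) u x} :=
  fun x y => edge (val x) (val y).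

Lemma component_edge_sym : symmetric component_edge.
Proof. by move=> x y; apply: edge_sym. Qed.

Lemma component_edge_irr : irreflexive component_edge.
Proof. by move=> x; apply: edge_irr. Qed.

Definition component := SGraph component_edge_sym component_edge_irr.

(** A walk in [G] from a vertex of the component never leaves it, so it lifts to the subtype; the
    induction carries the membership proof along. *)
Lemma component_connected : connected component.
Proof.
have csym : connect_sym component_edge.
  exact/sym_connect_sym/component_edge_sym.
have ux : forall x : component, connect component_edge (exist _ u (connect0 _ u)) x.
  suff main p (v : G) (uv : connect (@edge G) u v) (x : component) :
      path (@edge G) v p -> last v p = val x ->
      connect component_edge (exist _ v uv) x.
    by move=> x; have /connectP[p pP pE] := valP x; apply: (main p).
  elim: p v uv => [|w p IH] v uv /=; first by move=> _ vx; apply: eq_connect0; apply: val_inj.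
  case/andP => vw wp wx.
  have uw : connect (@edge G) u w by apply: connect_trans uv (connect1 vw).
  by apply: connect_trans (IH w uw wp wx); apply: connect1.
move=> x y; rewrite -[connect _ x y]/(connect component_edge x y).
by apply: connect_trans (ux y); rewrite csym.
Qed.

End Component.

Lemma linked_pack_contains_member (G : sgraph) n :
  linked_pack (@edge G) n -> contains_member (cnK3 n) G.
Proof.
case=> u /(tripack_embedding (@edge_sym G) (@edge_irr G))[f [f_inj f_hom fS]].
have fu p : connect (@edge G) u (f p) by have := fS p; rewrite inE.
exists (component u); last by exists val => //; apply: val_inj.
split; first exact: component_connected.
exists (fun p => exist _ (f p) (fu p) : component u) => [p q [] /f_inj //|p q].
exact: f_hom.
Qed.

Lemma contains_member_embedding (G : sgraph) n : contains_member (cnK3 n) G ->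
  exists f : 'I_n * 'I_3 -> G,
    [/\ injective f, forall p q, nK3_edge p q -> edge (f p) (f q)
      & forall p q, connect (@edge G) (f p) (f q)].
Proof.
case=> H [Hcon [g g_inj g_hom]] [h h_inj h_hom].
exists (h \o g); split; first exact: inj_comp.
  by move=> p q pq; apply/h_hom/g_hom.
move=> p q; have /connectP[s] := Hcon (g p) (g q) => /=.
elim: s (g p) => [|y s IH] x /=; first by move=> _ ->.
case/andP => xy ys qE; apply: connect_trans (IH y ys qE).
exact/connect1/h_hom.
Qed.

Lemma card_inj_ltn (T : finType) (h : T -> nat) m :
  injective h -> (forall x, h x < m) -> #|T| <= m.
Proof.
move=> h_inj hm; rewrite -[m in X in _ <= X]card_ord.
by apply: (@leq_card _ _ (fun x => Ordinal (hm x))) => x y [] /h_inj.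
Qed.

(** * The three-part colouring for the lower bound *)

Section LowerBound.
Variables n M : nat.
Hypotheses (n_gt0 : 0 < n) (M_lt : M < 7 * n - 2).

(** The sum of two booleans numbers by 0, 1, 2 the consecutive blocks starting at 0, [3 * n - 1] and
    [6 * n - 2]; as [M < 7 * n - 2], the last has at most [n - 1] vertices. *)
Definition part (x : nat) := (3 * n - 1 <= x) + (6 * n - 2 <= x).

Definition part_coloring (A : {set 'I_M}) :=
  [forall x in A, forall y in A, part x == part y].

Lemma part_coloring2 (x y : 'I_M) : part_coloring [set x; y] = (part x == part y).
Proof.
apply/forall_inP/eqP => [P|xy u].
  have /forall_inP/(_ y) := P x (set21 x y).
  by rewrite set22 => /(_ isT)/eqP.
by rewrite !inE => /orP[]/eqP->; apply/forall_inP => v; rewrite !inE => /orP[]/eqP->; rewrite ?xy.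
Qed.

Lemma part_coloring_true : ~ contains_member (cnK3 n) (color_graph part_coloring true).
Proof.
case/contains_member_embedding => f [f_inj _ f_con].
pose p0 : 'I_n * 'I_3 := (Ordinal n_gt0, ord0).
have fpart p : part (f p) = part (f p0).
  have cl : closed (color_edge part_coloring true) [pred x : 'I_M | part x == part (f p0)].
    by move=> x y; rewrite /color_edge part_coloring2 !inE eqb_id => /andP[_ /eqP->].
  by have := closed_connect cl (f_con p0 p); rewrite !inE eqxx => /esym/eqP.
(* [o] is where the part containing all the triangles starts; subtracting it would inject [3 * n]
   vertices into [3 * n - 1] places. *)
pose o := if part (f p0) is k.+1 then if k is 0 then 3 * n - 1 else 6 * n - 2 else 0.
have f_ge p : o <= f p < o + (3 * n - 1).
  have := fpart p; have := ltn_ord (f p); rewrite /o.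
  by case: (part (f p0)) => [|[|k]]; rewrite /part; lia.
have h_inj : injective (fun p => f p - o).
  by move=> p q pq; apply/f_inj/val_inj => /=; have := f_ge p; have := f_ge q; lia.
have h_lt p : f p - o < 3 * n - 1 by have := f_ge p; lia.
by have := card_inj_ltn h_inj h_lt; rewrite card_prod !card_ord; lia.
Qed.

Lemma part_coloring_false : ~ contains_member (cnK3 n) (color_graph part_coloring false).
Proof.
case/contains_member_embedding => f [f_inj f_hom _].
have neq i a a' : a != a' -> part (f (i, a)) != part (f (i, a')).
  move=> aa'; have /f_hom : nK3_edge (i, a) (i, a') by rewrite /nK3_edge eqxx.
  by rewrite /= /color_edge part_coloring2 eqbF_neg => /andP[].
(* The corners of a blue triangle lie in three different parts, hence one in the last; [a] picks
   such a corner for every triangle. *)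
have /fin_all_exists[a ha] : forall i, exists a : 'I_3, 6 * n - 2 <= f (i, a).
  move=> i; pose a k := f (i, inord k).
  have ne k l : k < 3 -> l < 3 -> k != l -> part (a k) != part (a l).
    move=> k3 l3 kl; apply: neq; apply: contra kl => /eqP/(congr1 val) /=.
    by rewrite !inordK // => ->.
  have := ne 0 1 isT isT isT; have := ne 0 2 isT isT isT; have := ne 1 2 isT isT isT.
  case: (leqP (6 * n - 2) (a 0)) => [|h0]; first by exists (inord 0).
  case: (leqP (6 * n - 2) (a 1)) => [|h1]; first by exists (inord 1).
  case: (leqP (6 * n - 2) (a 2)) => [|h2]; first by exists (inord 2).
  by rewrite /part; lia.
have h_inj : injective (fun i => f (i, a i) - (6 * n - 2)).
  move=> i j /= ij; suff /f_inj[] : f (i, a i) = f (j, a j) by [].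
  by apply: val_inj; have := ha i; have := ha j; rewrite /=; lia.
have h_lt i : f (i, a i) - (6 * n - 2) < n - 1.
  by have := ha i; have := ltn_ord (f (i, a i)); move: (nat_of_ord _) => x; lia.
by have := card_inj_ltn h_inj h_lt; rewrite !card_ord; lia.
Qed.

End LowerBound.

Theorem theorem1 (n : nat) (hn : 2 <= n) :
  is_ramsey_number (cnK3 n) (cnK3 n) (7 * n - 2).
Proof.
split=> [|c|M _ arrow]; first by lia.
  have rb x y : x != y -> color_edge c true x y || color_edge c false x y.
    by rewrite /color_edge => ->; case: (c _).
  have := linked_pack_two_colours (color_edge_sym c true) (color_edge_sym c false).
  move=> /(_ n (color_edge_irr c true) (color_edge_irr c false) rb hn).
  rewrite card_ord leqnn => /(_ isT).
  by case=> P; [left|right]; apply: linked_pack_contains_member.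
rewrite leqNgt; apply/negP => M_lt.
have n_gt0 : 0 < n by lia.
by case: (arrow (@part_coloring n M)); [apply: part_coloring_true|apply: part_coloring_false].
Qed.
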